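(* Let $R,L,J,m,D_p,D_q,V,\omega_g,\omega_n,v_{\rm set},K>0$ and $T_m,Q_{\rm set}\in\mathbb{R}$, and consider the fifth order model of the context, with $\tilde T_m$ and $\tilde Q$ defined there. Then the model has equilibrium points if and only if $$4R^2\tilde Q^2\le V^4+4RV^2\tilde T_m\omega_g. \qquad (E)$$ Suppose that (E) holds, and denote by $P_l\le P_r$ the two real solutions $P$ of $$\tilde T_m\omega_g=P+R\,\frac{P^2+\tilde Q^2}{V^2},$$ so that $\frac{P_l+P_r}{2}=-\frac{V^2}{2R}$. At every equilibrium point the active power satisfies $P=P_l$ or $P=P_r$. Let $M=-\frac{V^2}{R^2+\omega_g^2L^2}\,(R,\ \omega_gL)\in\mathbb{R}^2$. If an equilibrium point is such that $(P,\tilde Q)\ne M$, then its angle $\delta^e$ satisfies $$\tan\delta^e=\frac{\omega_gLP-R\tilde Q}{RP+\omega_gL\tilde Q+V^2},$$ (where, if the denominator is zero, this means $\delta^e=\pm\pi/2$ modulo $2\pi$). Assume moreover that $(P_l,\tilde Q)\neq M$ and $(P_r,\tilde Q)\ne M$, and that the angle $\delta$ is measured modulo $2\pi$. If (E) holds with strict inequality, then the model has precisely four equilibrium points. Two of them, denoted $\mathbf{z}_r^e$ and $\mathbf{z}_l^e$, have the property that $i_f^e>0$; at $\mathbf{z}_r^e$ we have $P=P_r$, and at $\mathbf{z}_l^e$ we have $P=P_l$. The other two are the symmetric equilibrium points $\tilde{\mathbf{z}}_r^e$ and $\tilde{\mathbf{z}}_l^e$, where $i_f^e<0$. If (E) holds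 with equality, then $P_l=P_r=-V^2/2R$ and the model has precisely two equilibrium points, which are a symmetric pair.
   Context: Fifth order (non-saturated) model: the state is $\mathbf{z}=[i_d\ i_q\ \omega\ \delta\ i_f]^\top\in\mathbb{R}^5$, and $$L\dot i_d=-Ri_d+\omega Li_q+V\sin\delta,\qquad L\dot i_q=-\omega Li_d-Ri_q-mi_f\omega+V\cos\delta,$$ $$J\dot\omega=mi_fi_q-D_p\omega+T_m+D_p\omega_n,\qquad \dot\delta=\omega-\omega_g,$$ $$m\,\dot i_f=k\,i_d\cos\delta-k\,i_q\sin\delta+\frac{k}{V}\tilde Q,\qquad k=\sqrt{\tfrac32}\,\frac{V}{K},$$ where $$\tilde Q=Q_{\rm set}+D_q\left(v_{\rm set}-\sqrt{\tfrac23}\,V\right),\qquad \tilde T_m=T_m+D_p(\omega_n-\omega_g).$$ The active power at a state is $P=-V[i_d\sin\delta+i_q\cos\delta]$. Angles are regarded modulo $2\pi$. Symmetric pairs: if $\mathbf{z}^e=[i_d^e\ i_q^e\ \omega_g\ \delta^e\ i_f^e]^\top$ is an equilibrium point of this model, then so is $\tilde{\mathbf{z}}^e=[-i_d^e\ -i_q^e\ \omega_g\ \delta^e+\pi\ -i_f^e]^\top$; $\mathbf{z}^e$ and $\tilde{\mathbf{z}}^e$ are called a symmetric pair. *)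

(* Defs.v *)
From Stdlib Require Import Reals List.
Open Scope R_scope.

(* [Rs] and [Ls] are the resistance R and the inductance L. *)
Record params : Type := mkParams {
  Rs : R; Ls : R; J : R; m : R;
  Dp : R; Dq : R; V : R; K : R;
  omega_g : R; omega_n : R; v_set : R;
  T_m : R; Q_set : R
}.

Record state : Type := mkState {
  i_d : R; i_q : R; omega : R; delta : R; i_f : R
}.

Definition zero_state : state := mkState 0 0 0 0 0.

Definition k (p : params) : R := sqrt (3 / 2) * (V p / K p).

Definition Q_tilde (p : params) : R :=
  Q_set p + Dq p * (v_set p - sqrt (2 / 3) * V p).

Definition T_tilde (p : params) : R :=
  T_m p + Dp p * (omega_n p - omega_g p).

(* The model in the form z' = vector_field p z, i.e. with each equation
   divided by the coefficient L, L, J, 1, m of its derivative. *)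
Definition vector_field (p : params) (z : state) : state :=
  mkState
    ((- Rs p * i_d z + omega z * Ls p * i_q z + V p * sin (delta z)) / Ls p)
    ((- omega z * Ls p * i_d z - Rs p * i_q z - m p * i_f z * omega z
        + V p * cos (delta z)) / Ls p)
    ((m p * i_f z * i_q z - Dp p * omega z + T_m p + Dp p * omega_n p) / J p)
    (omega z - omega_g p)
    ((k p * i_d z * cos (delta z) - k p * i_q z * sin (delta z)
        + k p / V p * Q_tilde p) / m p).

Definition equilibrium (p : params) (z : state) : Prop :=
  vector_field p z = zero_state.

Definition active_power (p : params) (z : state) : R :=
  - V p * (i_d z * sin (delta z) + i_q z * cos (delta z)).

Definition angle_eq (a b : R) : Prop :=
  exists n : Z, a = b + 2 * PI * IZR n.

(* Equality of states whose angle is measured modulo 2 pi. *)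
Definition state_eq (z z' : state) : Prop :=
  i_d z = i_d z' /\ i_q z = i_q z' /\ omega z = omega z' /\
  angle_eq (delta z) (delta z') /\ i_f z = i_f z'.

(* The other member of the symmetric pair containing the equilibrium [z],
   for which [omega z = omega_g]. *)
Definition symmetric (z : state) : state :=
  mkState (- i_d z) (- i_q z) (omega z) (delta z + PI) (- i_f z).

(* The equilibrium points, with angle modulo 2 pi, are those represented by
   the entries of [l], and distinct entries represent distinct points; so
   there are precisely [length l] of them. *)
Definition equilibria_listed_by (p : params) (l : list state) : Prop :=
  (forall z : state, equilibrium p z <-> Exists (state_eq z) l) /\
  ForallOrdPairs (fun z z' => ~ state_eq z z') l.

Definition power_balance (p : params) (P : R) : Prop :=
  T_tilde p * omega_g p = P + Rs p * ((P ^ 2 + Q_tilde p ^ 2) / V p ^ 2).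

Definition M (p : params) : R * R :=
  (- (V p ^ 2 / (Rs p ^ 2 + omega_g p ^ 2 * Ls p ^ 2)) * Rs p,
   - (V p ^ 2 / (Rs p ^ 2 + omega_g p ^ 2 * Ls p ^ 2)) * (omega_g p * Ls p)).

(* tan a = num / den, read as a = +-pi/2 modulo 2 pi when den = 0.  The
   conjunct [cos a <> 0] is needed because [tan] and [/] are total. *)
Definition tan_eq_ratio (a num den : R) : Prop :=
  (den <> 0 -> cos a <> 0 /\ tan a = num / den) /\
  (den = 0 -> angle_eq a (PI / 2) \/ angle_eq a (- (PI / 2))).

(* Main.v *)
(** In the frame rotated by the angle, the currents of an equilibrium are
    [-P/V] and [-Q/V].  The two stator equations then say that the vector
    [(D, N)], with [D = R P + wL Q + V^2] and [N = wL P - R Q], is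
    [m w V i_f] times [(cos delta, sin delta)], and given this the torque
    equation is the quadratic power balance for [P].  Hence a root [P] with
    [(D, N) <> 0], that is [(P, Q) <> M], determines [i_f] up to sign, and
    the sign determines the angle. *)
Require Import Defs.
From Stdlib Require Import Reals List Lra.
Import ListNotations.
Open Scope R_scope.

(** * Trigonometry: polar coordinates and angles modulo [2 * PI] *)

Lemma sin2_plus_cos2 (x : R) : sin x * sin x + cos x * cos x = 1.
Proof. exact (sin2_cos2 x). Qed.

(** Since [acos x] has nonnegative sine, the sign of [y] decides between [acos x] and its
    negative. *)
Lemma unit_vector_angle (x y : R) :
  x * x + y * y = 1 -> exists t : R, cos t = x /\ sin t = y.
Proof.
  intros H.
  assert (Hx : -1 <= x <= 1) by nra.
  assert (Hs : sin (acos x) = Rabs y).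
  { rewrite (sin_acos x Hx), <- (sqrt_Rsqr_abs y).
    f_equal; unfold Rsqr; lra. }
  destruct (Rle_or_lt 0 y) as [Hy | Hy].
  - exists (acos x); split; [exact (cos_acos x Hx)|].
    rewrite Hs; apply Rabs_pos_eq; lra.
  - exists (- acos x); rewrite cos_neg, sin_neg, Hs.
    split; [exact (cos_acos x Hx)|].
    rewrite Rabs_left by lra; ring.
Qed.

(** The origin is allowed, with [r = 0] and any angle, so that equilibria can later be built even
    when [(P, Q_tilde p) = M p]. *)
Lemma polar_form (x y : R) :
  exists r t : R, 0 <= r /\ x = r * cos t /\ y = r * sin t.
Proof.
  destruct (Req_dec (x * x + y * y) 0) as [H0 | H0].
  - exists 0, 0; repeat split; nra.
  - assert (Hpos : 0 < x * x + y * y) by nra.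
    set (r := sqrt (x * x + y * y)).
    assert (Hr : 0 < r) by (apply sqrt_lt_R0; exact Hpos).
    assert (Hrr : r * r = x * x + y * y) by (apply sqrt_sqrt; lra).
    destruct (unit_vector_angle (x / r) (y / r)) as [t [Hc Hs]].
    { replace (x / r * (x / r) + y / r * (y / r))
        with ((x * x + y * y) / (r * r)) by (field; lra).
      rewrite Hrr; field; lra. }
    exists r, t; rewrite Hc, Hs; repeat split; [lra | field; lra | field; lra].
Qed.

(** The hypotheses give [cos (a - b) = 1]. As [cos (2 x) = 1 - 2 sin^2 x], half the difference is a
    zero of the sine, hence a multiple of [PI]. *)
Lemma angle_eq_of_cos_sin (a b : R) :
  cos a = cos b -> sin a = sin b -> angle_eq a b.
Proof.
  intros Hc Hs.
  assert (H : cos (a - b) = 1).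
  { rewrite cos_minus, Hc, Hs.
    pose proof (sin2_plus_cos2 b); lra. }
  assert (H2 : sin ((a - b) / 2) = 0).
  { replace (a - b) with (2 * ((a - b) / 2)) in H by field.
    rewrite cos_2a_sin in H; nra. }
  destruct (sin_eq_0_0 _ H2) as [n Hn].
  exists n; lra.
Qed.

Lemma cos_sin_of_angle_eq (a b : R) :
  angle_eq a b -> cos a = cos b /\ sin a = sin b.
Proof.
  intros [n ->].
  assert (Hn : sin (IZR n * PI) = 0) by (apply sin_eq_0_1; now exists n).
  replace (2 * PI * IZR n) with (2 * (IZR n * PI)) by ring.
  rewrite cos_plus, sin_plus, sin_2a, cos_2a_sin, Hn; split; ring.
Qed.

Lemma angle_eq_half_PI (a : R) :
  cos a = 0 -> angle_eq a (PI / 2) \/ angle_eq a (- (PI / 2)).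
Proof.
  intros H.
  pose proof (sin2_plus_cos2 a) as H1.
  assert (Hs : (sin a - 1) * (sin a + 1) = 0) by nra.
  destruct (Rmult_integral _ _ Hs); [left | right];
    apply angle_eq_of_cos_sin;
    rewrite ?cos_neg, ?sin_neg, ?cos_PI2, ?sin_PI2; lra.
Qed.

(** * The power balance as a quadratic in [P] *)

(** This is [N] as a function of [P], with [Q] fixed at [Q_tilde]; [tan_den] is [D] likewise. *)
Definition tan_num (p : params) (P : R) : R :=
  omega_g p * Ls p * P - Rs p * Q_tilde p.

Definition tan_den (p : params) (P : R) : R :=
  Rs p * P + omega_g p * Ls p * Q_tilde p + V p ^ 2.

(** Discriminant of [R P^2 + V^2 P + R Q^2 - T w V^2], where [T] is [T_tilde]: the power balance
    multiplied by [V^2]. Condition (E) says that it is nonnegative. *)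
Definition discriminant (p : params) : R :=
  V p ^ 4 + 4 * Rs p * V p ^ 2 * T_tilde p * omega_g p
  - 4 * Rs p ^ 2 * Q_tilde p ^ 2.

(** The currents come from rotating back those with components [-P/V] and [-Q/V] in the frame of
    angle [d]. *)
Definition point_of (p : params) (P d f : R) : state :=
  mkState (- (P * sin d + Q_tilde p * cos d) / V p)
          (- (P * cos d - Q_tilde p * sin d) / V p)
          (omega_g p) d f.

Lemma active_power_point_of (p : params) (P d f : R) :
  0 < V p -> active_power p (point_of p P d f) = P.
Proof.
  intros hV; unfold active_power, point_of; simpl.
  transitivity (P * (sin d * sin d + cos d * cos d)); [field; lra|].
  rewrite sin2_plus_cos2; ring.
Qed.

(** Completing the square, after multiplication by [4 R V^2]. *)
Lemma power_balance_square (p : params) (P : R) :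
  0 < Rs p -> 0 < V p ->
  power_balance p P <-> (2 * Rs p * P + V p ^ 2) ^ 2 = discriminant p.
Proof.
  intros hR hV; unfold power_balance, discriminant.
  assert (hV2 : V p ^ 2 <> 0) by (apply pow_nonzero; lra).
  split; intros H.
  - replace (V p ^ 4 + 4 * Rs p * V p ^ 2 * T_tilde p * omega_g p)
      with (V p ^ 4 + 4 * Rs p * V p ^ 2 * (T_tilde p * omega_g p)) by ring.
    rewrite H; field; lra.
  - apply (Rmult_eq_reg_l (4 * Rs p * V p ^ 2)).
    2: { apply Rmult_integral_contrapositive_currified; [lra | exact hV2]. }
    transitivity ((2 * Rs p * P + V p ^ 2) ^ 2 - V p ^ 4
                  + 4 * Rs p ^ 2 * Q_tilde p ^ 2); [rewrite H; ring|].
    field; lra.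
Qed.

(** The mixed terms [w L P Q] cancel in [P D - Q N], leaving [R (P^2 + Q^2) + V^2 P]. This is the
    form in which the torque equation produces the balance. *)
Lemma power_balance_cleared (p : params) (P : R) :
  0 < V p ->
  power_balance p P <->
  P * tan_den p P - Q_tilde p * tan_num p P
    = T_tilde p * omega_g p * V p ^ 2.
Proof.
  intros hV; unfold power_balance, tan_den, tan_num.
  assert (hV2 : V p ^ 2 <> 0) by (apply pow_nonzero; lra).
  split; intros H.
  - rewrite H; field; lra.
  - apply (Rmult_eq_reg_r (V p ^ 2)); [|exact hV2].
    rewrite <- H; field; lra.
Qed.

(** * Reduction of the equilibrium equations to [P], the angle and [i_f] *)

Lemma k_pos (p : params) : 0 < V p -> 0 < K p -> 0 < k p.
Proof.
  intros hV hK; unfold k; apply Rmult_lt_0_compat.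
  - apply sqrt_lt_R0; lra.
  - apply Rdiv_lt_0_compat; assumption.
Qed.

Lemma div_eq_0_iff (x y : R) : 0 < y -> x / y = 0 <-> x = 0.
Proof.
  intros hy; split; intros H.
  - replace x with (x / y * y) by (field; lra); rewrite H; ring.
  - rewrite H; field; lra.
Qed.

(** The angle equation fixes the frequency, which turns the constant torque terms into [T_tilde].
    The field equation is a positive multiple of the last equation, because [k p > 0]. *)
Lemma equilibrium_equations (p : params) (z : state) :
  0 < Ls p -> 0 < J p -> 0 < m p -> 0 < V p -> 0 < K p ->
  equilibrium p z <->
  omega z = omega_g p /\
  - Rs p * i_d z + omega_g p * Ls p * i_q z + V p * sin (delta z) = 0 /\
  - omega_g p * Ls p * i_d z - Rs p * i_q z - m p * i_f z * omega_g p
    + V p * cos (delta z) = 0 /\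
  m p * i_f z * i_q z + T_tilde p = 0 /\
  V p * (i_d z * cos (delta z) - i_q z * sin (delta z)) = - Q_tilde p.
Proof.
  intros hL hJ hm hV hK.
  pose proof (k_pos p hV hK) as hk.
  assert (Hk : forall x, (k p * i_d z * cos (delta z)
                - k p * i_q z * sin (delta z) + k p / V p * x) / m p
    = k p / (V p * m p)
      * (V p * (i_d z * cos (delta z) - i_q z * sin (delta z)) + x))
    by (intros x; field; lra).
  assert (hk' : 0 < k p / (V p * m p))
    by (apply Rdiv_lt_0_compat; [|apply Rmult_lt_0_compat]; assumption).
  unfold equilibrium, vector_field, zero_state, T_tilde; rewrite Hk.
  split.
  - intros H; injection H as H1 H2 H3 H4 H5.
    assert (Hw : omega z = omega_g p) by lra.
    rewrite Hw in H1, H2, H3.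
    rewrite div_eq_0_iff in H1, H2, H3 by assumption.
    destruct (Rmult_integral _ _ H5); [lra|].
    repeat split; lra.
  - intros (Hw & H1 & H2 & H3 & H5); rewrite Hw.
    f_equal.
    + apply (div_eq_0_iff _ _ hL); lra.
    + apply (div_eq_0_iff _ _ hL); lra.
    + apply (div_eq_0_iff _ _ hJ); lra.
    + lra.
    + rewrite H5; ring.
Qed.

Lemma equilibrium_point_of (p : params) (P d f : R) :
  0 < Ls p -> 0 < J p -> 0 < m p -> 0 < V p -> 0 < omega_g p -> 0 < K p ->
  equilibrium p (point_of p P d f) <->
  power_balance p P /\
  tan_den p P = m p * omega_g p * V p * f * cos d /\
  tan_num p P = m p * omega_g p * V p * f * sin d.
Proof.
  intros hL hJ hm hV hw hK.
  rewrite equilibrium_equations, power_balance_cleared by assumption.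
  unfold point_of; simpl i_d; simpl i_q; simpl omega; simpl delta; simpl i_f.
  pose proof (sin2_plus_cos2 d) as Hd.
  set (s := sin d) in *; set (c := cos d) in *.
  set (r := m p * omega_g p * V p * f).
  (* With [r = m w V f], [E1] and [E2] identify the stator residuals, up to the factor [1/V], with
     [(D, N)] rotated by [-d] minus the vector of length [r] along the first axis. *)
  assert (E1 : - Rs p * (- (P * s + Q_tilde p * c) / V p)
      + omega_g p * Ls p * (- (P * c - Q_tilde p * s) / V p) + V p * s
      = (s * tan_den p P - c * tan_num p P) / V p)
    by (unfold tan_den, tan_num; field; lra).
  assert (E2 : - omega_g p * Ls p * (- (P * s + Q_tilde p * c) / V p)
      - Rs p * (- (P * c - Q_tilde p * s) / V p)
      - m p * f * omega_g p + V p * c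
      = (s * tan_num p P + c * tan_den p P - r) / V p)
    by (unfold tan_den, tan_num, r; field; lra).
  (* Here [m f = r / (w V)]; once [r c = D] and [r s = N], the numerator vanishes exactly when the
     cleared power balance holds. *)
  assert (E3 : m p * f * (- (P * c - Q_tilde p * s) / V p) + T_tilde p
      = (T_tilde p * omega_g p * V p ^ 2 - r * (P * c - Q_tilde p * s))
        / (omega_g p * V p ^ 2))
    by (unfold r; field; lra).
  (* The field equation holds identically, by the choice of currents in [point_of]. *)
  assert (E5 : V p * (- (P * s + Q_tilde p * c) / V p * c
      - - (P * c - Q_tilde p * s) / V p * s) = - Q_tilde p).
  { transitivity (- Q_tilde p * (s * s + c * c)); [field; lra|].
    rewrite Hd; ring. }
  assert (hwV : 0 < omega_g p * V p ^ 2)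
    by (apply Rmult_lt_0_compat; [|apply pow_lt]; assumption).
  rewrite E1, E2, E3, E5, !div_eq_0_iff by assumption.
  set (N := tan_num p P); set (D := tan_den p P).
  split.
  - intros (_ & H1 & H2 & H3 & _).
    (* The inverse rotation recovers [D], and then [N], from the two stator equations. *)
    assert (HD : D = r * c).
    { transitivity (D * (s * s + c * c)); [rewrite Hd; ring|].
      transitivity (s * (s * D - c * N) + c * (s * N + c * D)); [ring|].
      rewrite H1; replace (s * N + c * D) with r by lra; ring. }
    assert (HN : N = r * s).
    { transitivity (N * (s * s + c * c)); [rewrite Hd; ring|].
      transitivity (- c * (s * D - c * N) + s * (s * N + c * D)); [ring|].
      rewrite H1; replace (s * N + c * D) with r by lra; ring. }
    repeat split; [|exact HD|exact HN].
    rewrite HD, HN; lra.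
  - intros (H3 & HD & HN); rewrite HD, HN in *.
    repeat split; try lra.
    transitivity (r * (s * s + c * c - 1)); [ring | rewrite Hd; ring].
Qed.

(** One rotated current is [-P/V] by definition of the active power, the other is [-Q/V] by the
    field equation; rotating back gives [i_d] and [i_q]. *)
Lemma equilibrium_is_point_of (p : params) (z : state) :
  0 < Ls p -> 0 < J p -> 0 < m p -> 0 < V p -> 0 < K p ->
  equilibrium p z ->
  z = point_of p (active_power p z) (delta z) (i_f z).
Proof.
  intros hL hJ hm hV hK Hz.
  apply equilibrium_equations in Hz; try assumption.
  destruct Hz as (Hw & _ & _ & _ & HQ).
  assert (HQ' : Q_tilde p
     = - V p * (i_d z * cos (delta z) - i_q z * sin (delta z))) by lra.
  unfold point_of, active_power; rewrite HQ', <- Hw.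
  pose proof (sin2_plus_cos2 (delta z)) as Hd.
  destruct z as [a b w d f]; simpl in *.
  f_equal.
  - transitivity (a * (sin d * sin d + cos d * cos d));
      [rewrite Hd; ring | field; lra].
  - transitivity (b * (sin d * sin d + cos d * cos d));
      [rewrite Hd; ring | field; lra].
Qed.

Lemma equilibrium_iff (p : params) (z : state) :
  0 < Ls p -> 0 < J p -> 0 < m p -> 0 < V p -> 0 < omega_g p -> 0 < K p ->
  equilibrium p z <->
  z = point_of p (active_power p z) (delta z) (i_f z) /\
  power_balance p (active_power p z) /\
  tan_den p (active_power p z)
    = m p * omega_g p * V p * i_f z * cos (delta z) /\
  tan_num p (active_power p z)
    = m p * omega_g p * V p * i_f z * sin (delta z).
Proof.
  intros hL hJ hm hV hw hK; split.
  - intros Hz; pose proof (equilibrium_is_point_of p z hL hJ hm hV hK Hz) as E.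
    split; [exact E|].
    apply equilibrium_point_of; try assumption.
    rewrite <- E; exact Hz.
  - intros [E H]; rewrite E.
    apply equilibrium_point_of; assumption.
Qed.

(** With [X = w L], the equations [R P + X Q = -V^2] and [X P - R Q = 0] form a linear system of
    determinant [-(R^2 + X^2)], which is nonzero; its solution is [M]. *)
Lemma tan_num_den_eq_0 (p : params) (P : R) :
  0 < Rs p -> tan_num p P = 0 -> tan_den p P = 0 -> (P, Q_tilde p) = M p.
Proof.
  unfold tan_num, tan_den, M; intros hR HN HD.
  set (X := omega_g p * Ls p) in *.
  replace (omega_g p ^ 2 * Ls p ^ 2) with (X ^ 2) by (unfold X; ring).
  assert (H : 0 < Rs p ^ 2 + X ^ 2) by nra.
  assert (HV : V p ^ 2 = - (Rs p * P + X * Q_tilde p)) by lra.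
  rewrite HV; f_equal; apply (Rmult_eq_reg_r (Rs p ^ 2 + X ^ 2)); try lra.
  - transitivity (Rs p * (Rs p * P + X * Q_tilde p) + X * (X * P - Rs p * Q_tilde p)).
    + ring.
    + rewrite HN; field; lra.
  - transitivity (X * (Rs p * P + X * Q_tilde p) - Rs p * (X * P - Rs p * Q_tilde p)).
    + ring.
    + rewrite HN; field; lra.
Qed.

(** * Existence, symmetry and uniqueness of equilibria for a given root [P] *)

(** The polar angle of [(D, N)] serves as [delta], and its length divided by [m w V] as [i_f]. The
    length may be zero, whence only [0 <= i_f z]. *)
Lemma exists_equilibrium (p : params) (P : R) :
  0 < Ls p -> 0 < J p -> 0 < m p -> 0 < V p -> 0 < omega_g p -> 0 < K p ->
  power_balance p P ->
  exists z : state, equilibrium p z /\ active_power p z = P /\ 0 <= i_f z.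
Proof.
  intros hL hJ hm hV hw hK HP.
  destruct (polar_form (tan_den p P) (tan_num p P)) as (r & d & Hr & HD & HN).
  assert (hmwV : 0 < m p * omega_g p * V p)
    by (repeat apply Rmult_lt_0_compat; assumption).
  exists (point_of p P d (r / (m p * omega_g p * V p))).
  rewrite active_power_point_of, equilibrium_point_of by assumption.
  replace (m p * omega_g p * V p * (r / (m p * omega_g p * V p)))
    with r by (field; lra).
  repeat split; try assumption.
  apply Rmult_le_pos; [exact Hr | apply Rlt_le, Rinv_0_lt_compat, hmwV].
Qed.

Lemma equilibrium_i_f_neq_0 (p : params) (z : state) :
  0 < Rs p -> 0 < Ls p -> 0 < J p -> 0 < m p -> 0 < V p -> 0 < omega_g p ->
  0 < K p ->
  equilibrium p z -> (active_power p z, Q_tilde p) <> M p -> i_f z <> 0.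
Proof.
  intros hR hL hJ hm hV hw hK Hz HM Hf; apply HM.
  apply equilibrium_iff in Hz; try assumption.
  destruct Hz as (_ & _ & HD & HN); rewrite Hf in HD, HN.
  apply tan_num_den_eq_0; [assumption | rewrite HN; ring | rewrite HD; ring].
Qed.

Lemma active_power_symmetric (p : params) (z : state) :
  active_power p (symmetric z) = active_power p z.
Proof.
  unfold active_power, symmetric; simpl.
  rewrite neg_sin, neg_cos; ring.
Qed.

Lemma equilibrium_symmetric (p : params) (z : state) :
  0 < Ls p -> 0 < J p -> 0 < m p -> 0 < V p -> 0 < K p ->
  equilibrium p z -> equilibrium p (symmetric z).
Proof.
  intros hL hJ hm hV hK.
  rewrite !equilibrium_equations by assumption.
  unfold symmetric; simpl; rewrite neg_sin, neg_cos.
  intros (Hw & H1 & H2 & H3 & H5); repeat split; lra.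
Qed.

Lemma active_power_state_eq (p : params) (z z' : state) :
  state_eq z z' -> active_power p z = active_power p z'.
Proof.
  intros (Ha & Hb & _ & Hd & _); unfold active_power.
  destruct (cos_sin_of_angle_eq _ _ Hd) as [-> ->].
  rewrite Ha, Hb; reflexivity.
Qed.

Lemma i_f_state_eq (z z' : state) : state_eq z z' -> i_f z = i_f z'.
Proof. intros (_ & _ & _ & _ & H); exact H. Qed.

Lemma equilibrium_state_eq (p : params) (z z' : state) :
  state_eq z z' -> equilibrium p z' -> equilibrium p z.
Proof.
  intros (Ha & Hb & Hw & Hd & Hf) Hz'.
  destruct (cos_sin_of_angle_eq _ _ Hd) as [Hc Hs].
  unfold equilibrium, vector_field.
  rewrite Ha, Hb, Hw, Hf, Hc, Hs; exact Hz'.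
Qed.

Lemma point_of_state_eq (p : params) (P d d' f : R) :
  cos d = cos d' -> sin d = sin d' ->
  state_eq (point_of p P d f) (point_of p P d' f).
Proof.
  intros Hc Hs; unfold state_eq, point_of; simpl; rewrite Hc, Hs.
  repeat split; apply angle_eq_of_cos_sin; assumption.
Qed.

(** Both states have the same [(D, N)], so cancelling the nonzero factor [m w V i_f] equates the
    cosines and sines of their angles. *)
Lemma equilibrium_state_eq_of_i_f (p : params) (z z' : state) :
  0 < Ls p -> 0 < J p -> 0 < m p -> 0 < V p -> 0 < omega_g p -> 0 < K p ->
  equilibrium p z -> equilibrium p z' ->
  active_power p z = active_power p z' -> i_f z = i_f z' -> i_f z' <> 0 ->
  state_eq z z'.
Proof.
  intros hL hJ hm hV hw hK Hz Hz' HP Hf Hf0.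
  apply equilibrium_iff in Hz; try assumption.
  apply equilibrium_iff in Hz'; try assumption.
  destruct Hz as (E & _ & HD & HN), Hz' as (E' & _ & HD' & HN').
  rewrite HP, Hf in E, HD, HN.
  rewrite HD' in HD; rewrite HN' in HN.
  assert (hmwV : 0 < m p * omega_g p * V p)
    by (repeat apply Rmult_lt_0_compat; assumption).
  assert (H0 : m p * omega_g p * V p * i_f z' <> 0)
    by (apply Rmult_integral_contrapositive_currified; lra).
  assert (H : state_eq (point_of p (active_power p z') (delta z) (i_f z'))
                       (point_of p (active_power p z') (delta z') (i_f z'))).
  { apply point_of_state_eq; symmetry.
    - exact (Rmult_eq_reg_l _ _ _ HD H0).
    - exact (Rmult_eq_reg_l _ _ _ HN H0). }
  rewrite <- E, <- E' in H; exact H.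
Qed.

(** The squared length of [(D, N)] is [(m w V i_f)^2] and depends on [P] only, so the two values of
    [i_f] agree up to sign. Opposite signs reduce to equal ones by passing to [symmetric z']. *)
Lemma equilibrium_symmetric_pair (p : params) (z z' : state) :
  0 < Ls p -> 0 < J p -> 0 < m p -> 0 < V p -> 0 < omega_g p -> 0 < K p ->
  equilibrium p z -> equilibrium p z' ->
  active_power p z = active_power p z' -> i_f z' <> 0 ->
  state_eq z z' \/ state_eq z (symmetric z').
Proof.
  intros hL hJ hm hV hw hK Hz Hz' HP Hf0.
  assert (Hff : (i_f z - i_f z') * (i_f z + i_f z') = 0).
  { pose proof Hz as (_ & _ & HD & HN)%equilibrium_iff; try assumption.
    pose proof Hz' as (_ & _ & HD' & HN')%equilibrium_iff; try assumption.
    assert (hmwV : 0 < m p * omega_g p * V p)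
      by (repeat apply Rmult_lt_0_compat; assumption).
    set (q := m p * omega_g p * V p) in *.
    assert (H : forall x y, x = q * i_f y * cos (delta y) -> forall x',
               x' = q * i_f y * sin (delta y) ->
               x * x + x' * x' = q * q * (i_f y * i_f y)).
    { intros x y -> x' ->.
      transitivity (q * q * (i_f y * i_f y)
        * (sin (delta y) * sin (delta y) + cos (delta y) * cos (delta y)));
        [ring | rewrite sin2_plus_cos2; ring]. }
    rewrite HP in HD, HN.
    pose proof (H _ _ HD _ HN) as H1; pose proof (H _ _ HD' _ HN') as H2.
    rewrite H1 in H2.
    apply Rmult_eq_reg_l in H2; [lra|].
    apply Rmult_integral_contrapositive_currified; lra. }
  destruct (Rmult_integral _ _ Hff); [left | right].
  - apply (equilibrium_state_eq_of_i_f p); try assumption; lra.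
  - apply (equilibrium_state_eq_of_i_f p); try assumption.
    + apply equilibrium_symmetric; assumption.
    + rewrite active_power_symmetric; exact HP.
    + simpl; lra.
    + simpl; lra.
Qed.

Lemma not_state_eq_symmetric (z z' : state) :
  0 < i_f z -> 0 < i_f z' -> ~ state_eq z (symmetric z').
Proof. intros H H' E; apply i_f_state_eq in E; simpl in E; lra. Qed.

Lemma not_state_eq_active_power (p : params) (z z' : state) :
  active_power p z <> active_power p z' -> ~ state_eq z z'.
Proof. intros H E; exact (H (active_power_state_eq p z z' E)). Qed.

(** * The angle formula and the roots of the power balance *)

(** Since [i_f z] is nonzero, [D] vanishes exactly when [cos (delta z)] does; otherwise the common
    factor [m w V i_f] cancels in [N / D]. *)
Lemma equilibrium_tan_eq_ratio (p : params) (z : state) :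
  0 < Rs p -> 0 < Ls p -> 0 < J p -> 0 < m p -> 0 < V p -> 0 < omega_g p ->
  0 < K p ->
  equilibrium p z -> (active_power p z, Q_tilde p) <> M p ->
  tan_eq_ratio (delta z) (tan_num p (active_power p z))
    (tan_den p (active_power p z)).
Proof.
  intros hR hL hJ hm hV hw hK Hz HM.
  pose proof (equilibrium_i_f_neq_0 p z hR hL hJ hm hV hw hK Hz HM) as Hf.
  apply equilibrium_iff in Hz; try assumption.
  destruct Hz as (_ & _ & -> & ->).
  assert (hmwV : 0 < m p * omega_g p * V p)
    by (repeat apply Rmult_lt_0_compat; assumption).
  split; intros H.
  - assert (Hc : cos (delta z) <> 0) by (intros Hc; apply H; rewrite Hc; ring).
    split; [exact Hc|].
    unfold tan; field; repeat split; lra.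
  - apply angle_eq_half_PI.
    destruct (Rmult_integral _ _ H) as [H0 | H0]; [|exact H0].
    destruct (Rmult_integral _ _ H0); lra.
Qed.

Lemma square_eq_iff (x d : R) :
  0 <= d -> x ^ 2 = d <-> x = - sqrt d \/ x = sqrt d.
Proof.
  intros Hd; pose proof (sqrt_sqrt d Hd) as Hs; split.
  - intros H.
    assert (H0 : (x + sqrt d) * (x - sqrt d) = 0) by lra.
    destruct (Rmult_integral _ _ H0); [left | right]; lra.
  - intros [-> | ->]; lra.
Qed.

Lemma power_balance_roots (p : params) (P : R) :
  0 < Rs p -> 0 < V p -> 0 <= discriminant p ->
  power_balance p P <->
  P = (- V p ^ 2 - sqrt (discriminant p)) / (2 * Rs p) \/
  P = (- V p ^ 2 + sqrt (discriminant p)) / (2 * Rs p).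
Proof.
  intros hR hV Hd.
  rewrite power_balance_square, square_eq_iff by assumption.
  set (r := sqrt (discriminant p)).
  split; (intros [H | H]; [left | right]).
  - replace r with (- (2 * Rs p * P + V p ^ 2)) by lra; field; lra.
  - rewrite <- H; field; lra.
  - rewrite H; field; lra.
  - rewrite H; field; lra.
Qed.

Theorem mainTheorem2 (p : params)
  (hR : 0 < Rs p) (hL : 0 < Ls p) (hJ : 0 < J p) (hm : 0 < m p)
  (hDp : 0 < Dp p) (hDq : 0 < Dq p) (hV : 0 < V p)
  (hwg : 0 < omega_g p) (hwn : 0 < omega_n p) (hvset : 0 < v_set p)
  (hK : 0 < K p) :
  ((exists z : state, equilibrium p z) <->
     4 * Rs p ^ 2 * Q_tilde p ^ 2
       <= V p ^ 4 + 4 * Rs p * V p ^ 2 * T_tilde p * omega_g p) /\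
  (forall z : state,
     equilibrium p z ->
     (active_power p z, Q_tilde p) <> M p ->
     tan_eq_ratio (delta z)
       (omega_g p * Ls p * active_power p z - Rs p * Q_tilde p)
       (Rs p * active_power p z + omega_g p * Ls p * Q_tilde p + V p ^ 2)) /\
  (4 * Rs p ^ 2 * Q_tilde p ^ 2
     <= V p ^ 4 + 4 * Rs p * V p ^ 2 * T_tilde p * omega_g p ->
   exists Pl Pr : R,
     Pl <= Pr /\
     (forall P : R, power_balance p P <-> P = Pl \/ P = Pr) /\
     (Pl + Pr) / 2 = - (V p ^ 2 / (2 * Rs p)) /\
     (forall z : state,
        equilibrium p z -> active_power p z = Pl \/ active_power p z = Pr) /\
     ((Pl, Q_tilde p) <> M p ->
      (Pr, Q_tilde p) <> M p ->
      (4 * Rs p ^ 2 * Q_tilde p ^ 2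
         < V p ^ 4 + 4 * Rs p * V p ^ 2 * T_tilde p * omega_g p ->
       exists zr zl : state,
         equilibria_listed_by p [zr; zl; symmetric zr; symmetric zl] /\
         0 < i_f zr /\ active_power p zr = Pr /\
         0 < i_f zl /\ active_power p zl = Pl /\
         i_f (symmetric zr) < 0 /\ i_f (symmetric zl) < 0) /\
      (4 * Rs p ^ 2 * Q_tilde p ^ 2
         = V p ^ 4 + 4 * Rs p * V p ^ 2 * T_tilde p * omega_g p ->
       Pl = Pr /\ Pr = - (V p ^ 2 / (2 * Rs p)) /\
       exists z : state, equilibria_listed_by p [z; symmetric z]))).
Proof.
  pose proof (fun z => equilibrium_iff p z hL hJ hm hV hwg hK) as Heq.
  assert (Hbal : forall z, equilibrium p z -> power_balance p (active_power p z))
    by (intros z Hz; apply Heq; exact Hz).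
  pose proof (fun P => exists_equilibrium p P hL hJ hm hV hwg hK) as Hex.
  pose proof (fun P => power_balance_roots p P hR hV) as Hroots.
  set (r := sqrt (discriminant p)) in Hroots.
  (* [sqrt] is nonnegative at every real argument, so this holds before (E) is assumed. *)
  assert (hr : 0 <= r) by apply sqrt_pos.
  split; [split|split].
  (* Necessity of (E): an equilibrium makes the discriminant a square. *)
  - intros [z Hz]; apply Hbal, power_balance_square in Hz; try assumption.
    pose proof (pow2_ge_0 (2 * Rs p * active_power p z + V p ^ 2)).
    unfold discriminant in Hz; lra.
  - intros HE.
    destruct (Hex ((- V p ^ 2 + r) / (2 * Rs p))) as (z & Hz & _).
    + apply Hroots; [unfold discriminant; lra | right; reflexivity].
    + exists z; exact Hz.
  - intros z Hz HM; apply equilibrium_tan_eq_ratio; assumption.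
  - intros HE.
    assert (Hd : 0 <= discriminant p) by (unfold discriminant; lra).
    specialize (fun P => Hroots P Hd).
    set (Pl := (- V p ^ 2 - r) / (2 * Rs p)) in Hroots.
    set (Pr := (- V p ^ 2 + r) / (2 * Rs p)) in Hroots.
    assert (Hdiff : Pr - Pl = r / Rs p) by (unfold Pl, Pr; field; lra).
    exists Pl, Pr; split; [|split; [|split; [|split]]].
    + assert (0 <= r / Rs p)
        by (apply Rmult_le_pos; [exact hr | apply Rlt_le, Rinv_0_lt_compat, hR]).
      lra.
    + exact Hroots.
    + unfold Pl, Pr; field; lra.
    + intros z Hz; apply Hroots, Hbal, Hz.
    + intros HMl HMr.
      (* Away from [M] the field current is nonzero, which makes the sign from [Hex] strict. *)
      assert (Hpos : forall P, power_balance p P -> (P, Q_tilde p) <> M p ->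
        exists z, equilibrium p z /\ active_power p z = P /\ 0 < i_f z).
      { intros P HP HM; destruct (Hex P HP) as (z & Hz & HPz & Hf).
        exists z; repeat split; try assumption.
        assert (i_f z <> 0)
          by (apply (equilibrium_i_f_neq_0 p); rewrite ?HPz; assumption).
        lra. }
      (* [zr] serves both cases: for equality in (E) it represents the double root. *)
      destruct (Hpos Pr) as (zr & Hzr & HPr & Hfr);
        [apply Hroots; auto | exact HMr |].
      pose proof (equilibrium_symmetric p zr hL hJ hm hV hK Hzr) as Hzr'.
      split; intros HE'.
      * destruct (Hpos Pl) as (zl & Hzl & HPl & Hfl);
          [apply Hroots; auto | exact HMl |].
        pose proof (equilibrium_symmetric p zl hL hJ hm hV hK Hzl) as Hzl'.
        assert (Hne : Pr <> Pl).
        { assert (0 < r) by (apply sqrt_lt_R0; unfold discriminant; lra).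
          assert (0 < r / Rs p) by (apply Rdiv_lt_0_compat; assumption).
          lra. }
        exists zr, zl; repeat split; try assumption.
        (* The active power of any equilibrium is one of the two roots; the state is then [zl] or
           [zr], or the symmetric partner. *)
        -- intros Hz; destruct (proj1 (Hroots _) (Hbal z Hz)) as [HP | HP].
           ++ destruct (equilibrium_symmetric_pair p z zl) as [E | E];
                try assumption; try lra; auto.
           ++ destruct (equilibrium_symmetric_pair p z zr) as [E | E];
                try assumption; try lra; auto.
        -- rewrite !Exists_cons, Exists_nil.
           intros [E | [E | [E | [E | []]]]];
             apply (equilibrium_state_eq p _ _ E); assumption.
        (* Of the six pairs, the two with equal signs of [i_f] are separated by active power, the
           other four by the sign of [i_f]. *)
        -- assert (Hne' : ~ state_eq zr zl)
             by (apply (not_state_eq_active_power p); lra).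
           assert (Hne'' : ~ state_eq (symmetric zr) (symmetric zl))
             by (apply (not_state_eq_active_power p);
                 rewrite !active_power_symmetric; lra).
           repeat constructor; try assumption;
             apply not_state_eq_symmetric; assumption.
        -- simpl; lra.
        -- simpl; lra.
      * assert (Hr0 : r = 0).
        { unfold r; rewrite <- sqrt_0; f_equal; unfold discriminant; lra. }
        assert (HPlr : Pl = Pr) by (unfold Pl, Pr; rewrite Hr0; field; lra).
        repeat split.
        -- exact HPlr.
        -- unfold Pr; rewrite Hr0; field; lra.
        -- exists zr; split.
           ++ intros z; rewrite !Exists_cons, Exists_nil; split.
              ** intros Hz.
                 assert (HP : active_power p z = active_power p zr)
                   by (destruct (proj1 (Hroots _) (Hbal z Hz)); lra).
                 destruct (equilibrium_symmetric_pair p z zr);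
                   try assumption; try lra; auto.
              ** intros [E | [E | []]];
                   apply (equilibrium_state_eq p _ _ E); assumption.
           ++ repeat constructor.
              apply not_state_eq_symmetric; assumption.
Qed.
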